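(* Let $n\ge1$. No finite subset of $R_n$ exists which separates nonequivalent points in $B_n$; that is, there is no finite set $\{f_1,\dots,f_m\}\subset R_n$ such that for every two points $v,v'\in[0,\infty)^{2n}$ that are not equivalent in $B_n$ there is an $i$ with $f_i(v)\ne f_i(v')$.
   Context: Write points of $[0,\infty)^{2n}$ as $((x_1,d_1),\dots,(x_n,d_n))$, where $(x_i,d_i)$ encodes an interval with left endpoint $x_i\ge0$ and length $d_i\ge0$. The order of the $n$ pairs is irrelevant for a barcode. Equivalence in $B_n$: two points of $[0,\infty)^{2n}$ are equivalent in $B_n$ if, after deleting some zero-length pairs $(x,0)$ from each of the two multisets of $n$ pairs, one obtains equal multisets. In terms of ordered tuples: first rearrange the $n$ pairs of each point in lexicographic order (comparing lengths first, then left endpoints); then $((x_1,d_1),\dots,(x_n,d_n))\sim((x_1',d_1'),\dots,(x_n',d_n'))$ if and only if for all $i$, $d_i=d_i'$ and ($x_i=x_i'$ or $d_i=0$). In particular, points differing by a permutation of the $n$ pairs are equivalent. $B_n$ is the set of equivalence classes. Tropical rational functions: a min-plus polynomial in variables $z_1,\dots,z_r$ is a function $\min_{1\le i\le s}(a_i+c_1^iz_1+\cdots+c_r^iz_r)$ with $s\ge1$, $a_i\in\mathbb{R}$ and nonnegative integers $c_j^i$. A tropical rational function is a function of the form $p-q$ with $p,q$ min-plus polynomials. $R_n$ is the semiring of tropical rational functions $f$ in the $2n$ variables $x_1,d_1,\dots,x_n,d_n$ that respect the equivalence classes of $B_n$, i.e. $f(v)=f(v')$ whenever $v,v'\in[0,\infty)^{2n}$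 are equivalent in $B_n$ (so on $[0,\infty)^{2n}$ such $f$ is invariant under permutations of the $n$ pairs). *)

(* Defs.v *)
From HB Require Import structures.
From mathcomp Require Import all_boot all_order all_algebra.
From mathcomp Require Import boolp classical_sets cardinality reals.

Set Implicit Arguments.
Unset Strict Implicit.
Unset Printing Implicit Defensive.

Import Order.TTheory GRing.Theory Num.Theory.
Local Open Scope ring_scope.

(* The number of terms is s.+1 >= 1. Since min is idempotent, starting the
   fold from the term of index 0 does not change the minimum. *)
Definition minplus_poly (R : realType) (r : nat) (p : 'rV[R]_r -> R) : Prop :=
  exists (s : nat) (a : 'I_s.+1 -> R) (c : 'I_s.+1 -> 'I_r -> nat),
  forall z : 'rV[R]_r,
    let term i := a i + \sum_(j < r) (c i j)%:R * z 0 j in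
    p z = \big[Num.min/term ord0]_(i < s.+1) term i.

Definition tropical_rational (R : realType) (r : nat) (f : 'rV[R]_r -> R) :
    Prop :=
  exists p q : 'rV[R]_r -> R,
    [/\ minplus_poly p, minplus_poly q & forall z, f z = p z - q z].

Definition nonneg_point (R : realType) (r : nat) (v : 'rV[R]_r) : Prop :=
  forall j, 0 <= v 0 j.

(* vec_mx is row-major, so v = (x_1, d_1, ..., x_n, d_n) is read as the list of
   pairs (x_i, d_i) = (left endpoint, length). *)
Definition pairs (R : realType) (n : nat) (v : 'rV[R]_(n * 2)) : seq (R * R) :=
  [seq (vec_mx v i 0, vec_mx v i 1) | i <- enum 'I_n].

(* z and z' are the deleted zero-length pairs, s is the common multiset that
   remains; multisets are lists up to perm_eq. *)
Definition equivB (R : realType) (n : nat) (v v' : 'rV[R]_(n * 2)) : Prop :=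
  exists s z z' : seq (R * R),
    [/\ all (fun b => b.2 == 0) z, all (fun b => b.2 == 0) z',
        perm_eq (pairs v) (z ++ s) & perm_eq (pairs v') (z' ++ s)].

(* The carrier of the semiring R_n. Its elements are functions on the whole of
   R^(2n); compatibility with equivB is only required on [0, +oo)^(2n). *)
Definition Rn (R : realType) (n : nat) : set ('rV[R]_(n * 2) -> R) :=
  fun f => tropical_rational f /\
    forall v v' : 'rV[R]_(n * 2), nonneg_point v -> nonneg_point v' ->
      equivB v v' -> f v = f v'.

Definition separates (R : realType) (n : nat)
    (F : set ('rV[R]_(n * 2) -> R)) : Prop :=
  forall v v' : 'rV[R]_(n * 2), nonneg_point v -> nonneg_point v' ->
    ~ equivB v v' -> exists2 f, F f & f v <> f v'.

(* Main.v *)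
(** Along a ray [w + t u] a min-plus polynomial is eventually affine in [t], and
    its slope, the least slope of its terms along [u], does not depend on [w].
    So the eventual slope of [f] in [R_n], moving the left endpoint of one bar
    of fixed length [d], does not depend on [d]. It vanishes for [d = 0], where
    [f] is constant, hence also for [d = 1]: no [f] in [R_n] distinguishes the
    bars [(x, 1)] and [(x + 1, 1)] when [x] is large, and finitely many [f]
    have a common threshold. *)
Require Import Defs.
From HB Require Import structures.
From mathcomp Require Import all_boot all_order all_algebra.
From mathcomp Require Import boolp classical_sets cardinality reals.
From mathcomp Require Import lra.

Set Implicit Arguments.
Unset Strict Implicit.
Unset Printing Implicit Defensive.

Import Order.TTheory GRing.Theory Num.Theory.
Local Open Scope classical_set_scope.
Local Open Scope ring_scope.

Definition eventually_affine (R : realType) (m : R) (h : R -> R) : Prop :=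
  exists b T : R, forall t, T <= t -> h t = b + m * t.

Lemma eventually_affineB (R : realType) (m m' : R) (h h' : R -> R) :
  eventually_affine m h -> eventually_affine m' h' ->
  eventually_affine (m - m') (fun t => h t - h' t).
Proof.
move=> [b [T hT]] [b' [T' hT']]; exists (b - b'), (Num.max T T') => t.
by rewrite ge_max => /andP[/hT-> /hT'->]; lra.
Qed.

(** For distinct slopes the line of smaller slope is eventually the lower one; for equal slopes the
    smaller intercept decides once and for all. *)
Lemma eventually_affine_min (R : realType) (m m' : R) (h h' : R -> R) :
  eventually_affine m h -> eventually_affine m' h' ->
  eventually_affine (Num.min m m') (fun t => Num.min (h t) (h' t)).
Proof.
wlog lemm' : m m' h h' / m <= m'.
  move=> H hm hm'; have /orP[mm'|m'm] := le_total m m'; first exact: H.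
  have [b [T hT]] := H _ _ _ _ m'm hm' hm; exists b, T => t /hT.
  by rewrite minC [Num.min m' m]minC.
move=> [b [T hT]] [b' [T' hT']]; rewrite (min_l lemm').
move: lemm'; rewrite le_eqVlt => /orP[/eqP emm'|ltmm'].
  exists (Num.min b b'), (Num.max T T') => t.
  rewrite ge_max => /andP[/hT-> /hT'->].
  by rewrite -emm' addr_minl.
(* The last entry is the abscissa where the two lines cross. *)
exists b, (Num.max (Num.max T T') ((b - b') / (m' - m))) => t.
rewrite !ge_max -andbA => /and3P[/hT-> /hT'->].
rewrite ler_pdivrMr ?subr_gt0// => hbt.
by apply: min_l; lra.
Qed.

Lemma eventually_affine_slope0 (R : realType) (m c : R) (h : R -> R) :
  eventually_affine m h -> (forall t, 0 <= t -> h t = c) -> m = 0.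
Proof.
(* At [t] and [t + 1] both descriptions of [h] apply, and the two values differ by [m]. *)
move=> [b [T hT]] hc; pose t := Num.max T 0.
have t0 : 0 <= t by rewrite le_max lexx orbT.
have tT : T <= t by rewrite le_max lexx.
have := hT t tT; have := hT (t + 1) ltac:(lra).
by rewrite !hc; lra.
Qed.

(** The order of quantifiers is the point: [m] is chosen before [w], since moving the base point
    changes only the constants of the terms. *)
Lemma minplus_poly_eventually_affine (R : realType) (r : nat)
    (p : 'rV[R]_r -> R) (u : 'rV[R]_r) :
  minplus_poly p ->
  exists m, forall w, eventually_affine m (fun t => p (w + t *: u)).
Proof.
move=> [s [a [c hp]]].
pose slope i := \sum_(j < r) (c i j)%:R * u 0 j.
exists (\big[Num.min/slope ord0]_(i < s.+1) slope i) => w.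
pose term i t := a i + \sum_(j < r) (c i j)%:R * (w + t *: u) 0 j.
have term_affine i : eventually_affine (slope i) (term i).
  exists (a i + \sum_(j < r) (c i j)%:R * w 0 j), 0 => t _.
  rewrite /term /slope -addrA mulr_suml -big_split /=; congr (_ + _).
  by apply: eq_bigr => j _; rewrite !mxE mulrDr [t * _]mulrC mulrA.
suff [b [T hT]] : eventually_affine
    (\big[Num.min/slope ord0]_(i < s.+1) slope i)
    (fun t => \big[Num.min/term ord0 t]_(i < s.+1) term i t).
  by exists b, T => t /hT <-; rewrite hp.
(* Both minima, of slopes and of terms, run over the same list. On the empty list each is its
   default, the entry of index [ord0]. *)
elim: (index_enum _) => [|i l IH].
  have [b [T hT]] := term_affine ord0.
  by exists b, T => t /hT; rewrite !big_nil.
have [b [T hT]] := eventually_affine_min (term_affine i) IH.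
by exists b, T => t /hT; rewrite !big_cons.
Qed.

Lemma tropical_rational_eventually_affine (R : realType) (r : nat)
    (f : 'rV[R]_r -> R) (u : 'rV[R]_r) :
  tropical_rational f ->
  exists m, forall w, eventually_affine m (fun t => f (w + t *: u)).
Proof.
move=> [p [q [/(minplus_poly_eventually_affine u)[m hp]]]].
move=> /(minplus_poly_eventually_affine u)[m' hq] hf; exists (m - m') => w.
have [b [T hT]] := eventually_affineB (hp w) (hq w).
by exists b, T => t /hT <-.
Qed.

(** One bar [(x, d)] padded with [n] pairs [(0, 0)], written in the form [w + t *: u] with [t = x],
    so that the direction [u] is the same for all [d]. *)
Definition barcode1 (R : realType) (n : nat) (x d : R) : 'rV[R]_(n.+1 * 2) :=
  d *: mxvec (delta_mx 0 1) + x *: mxvec (delta_mx 0 0).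

Lemma pairs_barcode1 (R : realType) (n : nat) (x d : R) :
  pairs (barcode1 n x d) =
  [seq (if i == 0 then (x, d) else (0, 0)) | i <- enum 'I_n.+1].
Proof.
apply: eq_map => i; rewrite linearD !linearZ /= !mxvecK !mxE /=.
by case: eqP => _; rewrite /= ?mulr0 ?mulr1 ?addr0 ?add0r.
Qed.

Lemma nonneg_barcode1 (R : realType) (n : nat) (x d : R) :
  0 <= x -> 0 <= d -> nonneg_point (barcode1 n x d).
Proof.
move=> x0 d0 j; rewrite !mxE; case/mxvec_indexP: j => i k.
by rewrite !mxvecE !mxE addr_ge0// mulr_ge0.
Qed.

Lemma equivB_barcode1_length0 (R : realType) (n : nat) (x x' : R) :
  equivB (barcode1 n x 0) (barcode1 n x' 0).
Proof.
(* All pairs have length zero, so everything is deleted on both sides. *)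
exists [::], (pairs (barcode1 n x 0)), (pairs (barcode1 n x' 0)).
split; rewrite ?cats0 // pairs_barcode1 all_map;
  by apply/allP => i _ /=; case: ifP => _ /=.
Qed.

(** A pair of nonzero length cannot be deleted, so [(x, d)] lies in the common part and recurs in
    the other barcode, whose padding has length zero. *)
Lemma equivB_barcode1_inj (R : realType) (n : nat) (x x' d : R) :
  d != 0 -> equivB (barcode1 n x d) (barcode1 n x' d) -> x = x'.
Proof.
move=> d0 [s [z [z' [/allP z0 _ /perm_mem vE /perm_mem v'E]]]].
have : (x, d) \in pairs (barcode1 n x d).
  by rewrite pairs_barcode1; apply/mapP; exists 0; rewrite ?mem_enum.
rewrite vE mem_cat => /orP[/z0/=|xs]; first by rewrite (negPf d0).
have : (x, d) \in pairs (barcode1 n x' d) by rewrite v'E mem_cat xs orbT.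
rewrite pairs_barcode1 => /mapP[i _]; case: ifP => _ [//].
by move=> _ /eqP; rewrite (negPf d0).
Qed.

Lemma Rn_barcode1_eventually_const (R : realType) (n : nat) (d : R)
    (f : 'rV[R]_(n.+1 * 2) -> R) :
  Rn f -> exists c T : R, forall x, T <= x -> f (barcode1 n x d) = c.
Proof.
move=> [/(tropical_rational_eventually_affine (mxvec (delta_mx 0 0)))[m hm] hf].
have m0 : m = 0.
  (* The ray with [d = 0] consists of mutually equivalent points for [t >= 0]. *)
  apply: (eventually_affine_slope0 (c := f (barcode1 n 0 0))
    (hm (0 *: mxvec (delta_mx 0 1)))) => t t0.
  apply: (hf (barcode1 n t 0)); last exact: equivB_barcode1_length0.
    exact: nonneg_barcode1.
  exact: nonneg_barcode1.
(* The same slope [m] serves the ray at length [d]. *)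
have [b [T hT]] := hm (d *: mxvec (delta_mx 0 1)).
by exists b, T => x /hT; rewrite m0 mul0r addr0.
Qed.

Lemma finite_set_common_threshold (R : realType) (T : choiceType) (F : set T)
    (P : T -> R -> Prop) :
  finite_set F ->
  (forall f, F f -> exists x0, forall x, x0 <= x -> P f x) ->
  exists x0, forall f, F f -> forall x, x0 <= x -> P f x.
Proof.
move=> /finite_seqP[s ->]; elim: s => [|g s IH] hP.
  by exists 0 => f /=; rewrite in_nil.
have [|x1 h1] := IH.
  by move=> f fs; apply: hP; rewrite /= in_cons (fs : f \in s) orbT.
have [|x2 h2] := hP g; first by rewrite /= mem_head.
exists (Num.max x1 x2) => f /=; rewrite in_cons => fs x.
rewrite ge_max => /andP[x1x x2x].
by case/orP: fs => [/eqP->|fs]; [exact: h2 | exact: h1].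
Qed.

Theorem theorem6p1 (R : realType) (n : nat) (hn : (1 <= n)%N) :
  ~ exists F : set ('rV[R]_(n * 2) -> R),
      [/\ finite_set F, F `<=` @Rn R n & separates F].
Proof.
case: n hn => // n _ [F [finF FRn sepF]].
have [|x0 hx0] := finite_set_common_threshold
    (P := fun (f : 'rV[R]_(n.+1 * 2) -> R) x =>
      f (barcode1 n x 1) = f (barcode1 n (x + 1) 1)) finF.
  move=> f /FRn/(Rn_barcode1_eventually_const 1)[c [x0 hc]].
  by exists x0 => x x0x; rewrite !hc //; lra.
(* The maximum with 0 keeps both barcodes in the nonnegative orthant. *)
pose x := Num.max x0 0.
have x_ge0 : 0 <= x by rewrite le_max lexx orbT.
have x0x : x0 <= x by rewrite le_max lexx.
have [|||f Ff] := sepF (barcode1 n x 1) (barcode1 n (x + 1) 1).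
- exact: nonneg_barcode1.
- by apply: nonneg_barcode1 => //; lra.
- by move/(equivB_barcode1_inj (oner_neq0 R)); lra.
by apply; exact: hx0.
Qed.
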